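(* Let $G$ be a causal graph satisfying the following three conditions. \begin{itemize} \item (NOC$\star$) $G$ admits a two-quasi-clique partition. \item (M1$\star$) Whenever $D_{i_1}\stackrel{!}{\to}D_{j_1}$, there is at least one two-quasi-clique partition of $G$ such that $D_{i_1}$ and $D_{j_1}$ belong to different quasi-cliques. \item (M3$\star$) Whenever $D_{i_1}$ and $D_{i_2}$ (possibly equal) belong to the same quasi-clique in every two-quasi-clique partition of $G$, and $D_{i_1}\stackrel{!}{\to}D_{j_1}$ and $D_{i_2}\stackrel{!}{\to}D_{j_2}$, then $D_{j_1}\sim D_{j_2}$. \end{itemize} Then the entanglement summoning task with causal graph $G$ is achievable.
   Context: All Hilbert spaces are finite-dimensional. A causal graph $G$ is a finite directed graph without self-loops with vertices $D_1,\dots,D_n$ (''diamonds''); write $D_i\to D_j$ if $(D_i,D_j)$ is an edge. $D_i\stackrel{!}{\to}D_j$ means $D_i\to D_j$ but not $D_j\to D_i$. For distinct diamonds, $D_i\not\sim D_j$ means neither $D_i\to D_j$ nor $D_j\to D_i$; otherwise $D_i\sim D_j$. (Convention: $D_j\sim D_j$ always holds.) A set of vertices is a quasi-clique if for every two distinct vertices $u,v$ in it at least one of $(u,v),(v,u)$ is an edge. A two-quasi-clique partition of $G=(V,E)$ is a pair $K_1,K_2\subseteq V$ with $K_1\cap K_2=\emptyset$, $K_1\cup K_2=V$ and both $K_1,K_2$ quasi-cliques (one may be empty). Entanglement summoning task with causal graph $G$: Alice pre-shares an arbitrary quantum state among systems $X_1,\dots,X_n$ ($X_i$ held at vertex $i$).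 Vertex $i$ receives a bit $b_i\in\{0,1\}$, where it is promised that exactly two of the bits equal $1$ (at an arbitrary pair $j^*\neq k^*$ unknown in advance). Alice then acts locally, uses one simultaneous round of quantum communication along the directed edges of $G$, and acts locally again. Formally, a protocol consists of a state on $X_1\cdots X_n$; for each $i$ and each $b\in\{0,1\}$ a quantum channel $\mathcal N_i^{b}$ from $X_i$ to a tensor product of systems $Y^{i\to j}$, where $j$ ranges over $j=i$ and all $j$ with $D_i\to D_j$; and for each $i$ and $b$ a quantum channel $\mathcal M_i^{b}$ from the tensor product of the systems $Y^{j\to i}$ ($j=i$ or $D_j\to D_i$) to an output system $A_i$. The task is achievable if there is a protocol such that for every pair $j^*\ne k^*$, when $b_{j^*}=b_{k^*}=1$ and all other bits are $0$, the resulting state of $A_{j^*}A_{k^*}$ is exactly a fixed maximally entangled state $|\Psi^+\rangle=\frac1{\sqrt d}\sum_{m}|m\rangle|m\rangle$ (with $d\ge 2$ fixed). *)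

(* Defs.v *)
From HB Require Import structures.
From mathcomp Require Import all_boot all_order all_algebra.

Set Implicit Arguments.
Unset Strict Implicit.
Unset Printing Implicit Defensive.

Import Order.TTheory GRing.Theory Num.Theory.
Local Open Scope ring_scope.
Local Open Scope sesquilinear_scope.

(* A finite-dimensional Hilbert space is given by a finType indexing an
   orthonormal basis.  The tensor product of a family of spaces has as basis
   the dependent functions choosing one basis label per factor. *)
Definition tensor_basis (I : finType) (T : I -> finType) : finType :=
  {dffun forall i, T i}.

Section Quantum.
Variable C : numClosedFieldType.

Definition op (T : finType) := 'M[C]_#|T|.

(* The matrix entry <x|A|y>. *)
Definition entry (T : finType) (A : op T) (x y : T) : C :=
  A (enum_rank x) (enum_rank y).

Definition mkop (T : finType) (f : T -> T -> C) : op T :=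
  \matrix_(i, j) f (enum_val i) (enum_val j).

(* The matrix unit |x><y|. *)
Definition ketbra (T : finType) (x y : T) : op T :=
  delta_mx (enum_rank x) (enum_rank y).

(* For z : C, [0 <= z] says that z is real and nonnegative. *)
Definition psd (T : finType) (A : op T) : Prop :=
  forall v : 'cV[C]_#|T|, 0 <= (v ^t* *m A *m v) 0 0.

Definition is_state (T : finType) (A : op T) : Prop := psd A /\ \tr A = 1.

(* (id_Anc (x) Phi)(A): Phi is applied to each block of A with fixed ancilla
   labels. *)
Definition ampliation (Anc S T : finType) (Phi : op S -> op T)
    (A : op (Anc * S)%type) : op (Anc * T)%type :=
  mkop (fun p q =>
    entry (Phi (mkop (fun s s' => entry A (p.1, s) (q.1, s')))) p.2 q.2).

Definition completely_positive (S T : finType) (Phi : op S -> op T) : Prop :=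
  forall (Anc : finType) (A : op (Anc * S)%type),
    psd A -> psd (ampliation Phi A).

Definition trace_preserving (S T : finType) (Phi : op S -> op T) : Prop :=
  forall A : op S, \tr (Phi A) = \tr A.

Record channel (S T : finType) := Channel {
  chan_map : {linear 'M[C]_#|S| -> 'M[C]_#|T|};
  chan_cp : completely_positive chan_map;
  chan_tp : trace_preserving chan_map
}.

(* The tensor product of the channels Phi i: the linear map sending
   (x)_i |x_i><x'_i| to (x)_i Phi_i(|x_i><x'_i|). *)
Definition tensor_channel (I : finType) (S T : I -> finType)
    (Phi : forall i, channel (S i) (T i)) (A : op (tensor_basis S)) :
    op (tensor_basis T) :=
  mkop (T := tensor_basis T) (fun y y' : {dffun forall i, T i} =>
    \sum_(x : {dffun forall i, S i}) \sum_(x' : {dffun forall i, S i})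
      entry (T := tensor_basis S) A x x' *
      \prod_(i : I) entry (chan_map (Phi i) (ketbra (x i) (x' i))) (y i) (y' i)).

(* Transport of an operator along a relabelling f of basis vectors. *)
Definition relabel (S T : finType) (f : T -> S) (A : op S) : op T :=
  mkop (fun x y => entry A (f x) (f y)).

(* The partial trace over all factors other than j and k, for j != k. *)
Definition marginal2 (I : finType) (T : I -> finType) (j k : I)
    (A : op (tensor_basis T)) : op (T j * T k)%type :=
  mkop (fun p q =>
    \sum_(x : {dffun forall i, T i} | (x j == p.1) && (x k == p.2))
    \sum_(y : {dffun forall i, T i} | [&& y j == q.1, y k == q.2 &
            [forall i, (i != j) && (i != k) ==> (x i == y i)]])
      entry (T := tensor_basis T) A x y).

Definition max_entangled_ket (d : nat) : 'cV[C]_#|{: 'I_d * 'I_d}| :=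
  \col_i (let p := enum_val i in
          if p.1 == p.2 then (sqrtC d%:R)^-1 else 0).

Definition max_entangled (d : nat) : op ('I_d * 'I_d)%type :=
  max_entangled_ket d *m (max_entangled_ket d) ^t*.

End Quantum.

Record causal_graph := CausalGraph {
  diamond :> finType;
  arrow : rel diamond;
  arrow_irrefl : irreflexive arrow
}.

Section Graph.
Variable G : causal_graph.

Definition one_way (u v : G) : bool := arrow u v && ~~ arrow v u.

Definition related (u v : G) : bool := [|| u == v, arrow u v | arrow v u].

Definition quasi_clique (K : {set G}) : Prop :=
  forall u v : G, u \in K -> v \in K -> u != v -> arrow u v || arrow v u.

Definition two_quasi_clique_partition (K1 K2 : {set G}) : Prop :=
  [/\ K1 :&: K2 = set0, K1 :|: K2 = [set: G],
      quasi_clique K1 & quasi_clique K2].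

Definition same_part (K1 K2 : {set G}) (u v : G) : bool :=
  (u \in K1) && (v \in K1) || (u \in K2) && (v \in K2).

Definition different_parts (K1 K2 : {set G}) (u v : G) : bool :=
  (u \in K1) && (v \in K2) || (u \in K2) && (v \in K1).

Definition NOCstar : Prop :=
  exists K1 K2 : {set G}, two_quasi_clique_partition K1 K2.

Definition M1star : Prop :=
  forall i1 j1 : G, one_way i1 j1 ->
    exists K1 K2 : {set G},
      two_quasi_clique_partition K1 K2 /\ different_parts K1 K2 i1 j1.

Definition M3star : Prop :=
  forall i1 i2 j1 j2 : G,
    (forall K1 K2 : {set G},
       two_quasi_clique_partition K1 K2 -> same_part K1 K2 i1 i2) ->
    one_way i1 j1 -> one_way i2 j2 -> related j1 j2.

(* A system Y^{u -> v} exists along each edge, and for v = u it is the local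
   memory of u. *)
Definition link (u v : G) : bool := (u == v) || arrow u v.

Definition outgoing (Y : G -> G -> finType) (u : G) : finType :=
  tensor_basis (fun v : {v : G | link u v} => Y u (val v)).

Definition incoming (Y : G -> G -> finType) (v : G) : finType :=
  tensor_basis (fun u : {u : G | link u v} => Y (val u) v).

(* The systems Y^{u -> v} regrouped by sender instead of by receiver. *)
Definition by_sender (Y : G -> G -> finType)
    (y : {dffun forall v, incoming Y v}) : tensor_basis (outgoing Y) :=
  [ffun u => [ffun v : {v : G | link u v} =>
    y (val v) (exist (fun w => link w (val v)) u (valP v))]].

End Graph.

Section Task.
Variables (C : numClosedFieldType) (d : nat) (G : causal_graph).

Record protocol := Protocol {
  shared : G -> finType;
  message : G -> G -> finType;
  resource : op C (tensor_basis shared);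
  resource_state : is_state resource;
  encode : forall (u : G) (b : bool),
    channel C (shared u) (outgoing message u);
  decode : forall (u : G) (b : bool),
    channel C (incoming message u) 'I_d
}.

Definition final_state (P : protocol) (b : G -> bool) :
    op C (tensor_basis (fun _ : G => 'I_d : finType)) :=
  tensor_channel (fun u => decode P u (b u))
    (relabel (T := tensor_basis (incoming (message P)))
      (@by_sender G (message P))
      (tensor_channel (fun u => encode P u (b u)) (resource P))).

Definition achievable : Prop :=
  exists P : protocol, forall j k : G, j != k ->
    marginal2 j k (final_state P (fun u => (u == j) || (u == k)))
      = max_entangled C d.

End Task.

(* Main.v *)
(** Call two vertices unrelated when no edge joins them. Unrelated vertices lie
    in different quasi-cliques of every partition, so inside a connected
    component D of the unrelatedness graph the two shores D_0, D_1 are forced.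
    Let T(Q) be the set of heads of one-way edges leaving Q. By M1 and M3 both
    D_0 + T(D_1) and D_1 + T(D_0) are quasi-cliques, and D_0 and T(D_0) are
    disjoint. A maximally entangled pair is attached to D, with one half to be
    summoned in D_0 + T(D_1) and the other one in D_1 + T(D_0); another pair is
    attached to each bidirected edge. A requested vertex that hears of no other
    request claims the half of its own shore. One that hears of a request at u
    claims the opposite half of the pair of u if it cannot be heard by u, and
    its half of the pair of the edge otherwise.

    A half m in Z_d is summoned in a quasi-clique S through the code
    m |-> sum over c : S -> Z_d with sum_u c_u = m of the basis states with
    value c_u at u and value c_u + c_w on each edge u -> w (choosing one
    direction for bidirected edges). The edge value starts at u, stays there if
    u is requested and moves to w otherwise. A requested v no in-neighbour of
    which in S is requested thus collects its whole star, from which it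
    computes m. All other values depend on the c_w with w <> v only, so they
    are independent of m and coherence is preserved. *)
From HB Require Import structures.
Require Import Defs.
From mathcomp Require Import all_boot all_order all_algebra.
From mathcomp Require Import complex reals.

Set Implicit Arguments.
Unset Strict Implicit.
Unset Printing Implicit Defensive.

Import Order.TTheory GRing.Theory Num.Theory.
Local Open Scope ring_scope.

(** * Channels induced by functions on basis labels, and uniform superpositions *)

Section Operators.
Variable C : numClosedFieldType.

Lemma entry_mkop (T : finType) (f : T -> T -> C) x y :
  entry (mkop f) x y = f x y.
Proof. by rewrite /entry mxE !enum_rankK. Qed.

Lemma sum_enum_rank (T : finType) (F : 'I_#|T| -> C) :
  \sum_i F i = \sum_(x : T) F (enum_rank x).
Proof. by rewrite (reindex _ (onW_bij _ (enum_rank_bij T))). Qed.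

Lemma op_eqP (T : finType) (A B : op C T) :
  (forall x y, entry A x y = entry B x y) -> A = B.
Proof.
by move=> AB; apply/matrixP=> i j; have := AB (enum_val i) (enum_val j);
  rewrite /entry !enum_valK.
Qed.

Lemma trace_entry (T : finType) (A : op C T) : \tr A = \sum_x entry A x x.
Proof. by rewrite /mxtrace sum_enum_rank. Qed.

Lemma psdP (T : finType) (A : op C T) :
  psd A <-> forall f : T -> C,
    0 <= \sum_x \sum_y (f x)^* * entry A x y * f y.
Proof.
have quadE (v : 'cV[C]_#|T|) : (v ^t* *m A *m v)%sesqui 0 0 =
    \sum_x \sum_y (v (enum_rank x) 0)^* * entry A x y * v (enum_rank y) 0.
  rewrite -mulmxA mxE sum_enum_rank; apply: eq_bigr => x _.
  rewrite !mxE sum_enum_rank big_distrr /=; apply: eq_bigr => y _.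
  by rewrite mulrA.
split=> [Apos f | Apos v]; last by rewrite quadE; apply: Apos.
have := Apos (\col_i f (enum_val i)); rewrite quadE.
by under eq_bigr do under eq_bigr do rewrite !mxE !enum_rankK.
Qed.

Section CoherentMap.
Variables (S T E : finType) (h : S -> T) (r : S -> E).

(* The map |y> |-> |h y>|r y> followed by the partial trace over the
   register holding r y. *)
Definition coherent_map (A : op C S) : op C T :=
  mkop (fun t t' => \sum_y \sum_(y' | [&& h y == t, h y' == t' & r y == r y'])
    entry A y y').

Lemma coherent_map_is_linear : linear coherent_map.
Proof.
move=> a A B; apply: op_eqP => t t'.
rewrite /entry !mxE mulr_sumr -big_split /=; apply: eq_bigr => y _.
rewrite mulr_sumr -big_split /=; apply: eq_bigr => y' _.
by rewrite /entry !mxE.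
Qed.

HB.instance Definition _ := GRing.isLinear.Build C 'M[C]_#|S| 'M[C]_#|T| _
  coherent_map coherent_map_is_linear.

(** The values e of [r] index a Kraus decomposition: [g e] is the pullback of the test vector [f]
    along the branch [r y = e], so the quadratic form is a sum over e of quadratic forms of [A]. *)
Lemma coherent_map_cp : completely_positive coherent_map.
Proof.
move=> Anc A /psdP Apos; apply/psdP => f.
pose g e (p : Anc * S) := (r p.2 == e)%:R * f (p.1, h p.2).
rewrite (_ : \sum_x _ = \sum_e \sum_p \sum_q (g e p)^* * entry A p q * g e q);
  last first.
  transitivity (\sum_(p : Anc * S) \sum_(q : Anc * S | r p.2 == r q.2)
     (f (p.1, h p.2))^* * entry A p q * f (q.1, h q.2)).
    pose F p q := (f (p.1, h p.2))^* * entry A p q * f (q.1, h q.2).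
    rewrite [RHS](partition_big (fun p : Anc * S => (p.1, h p.2)) predT) //=.
    apply: eq_bigr => -[a t] _.
    under [RHS]eq_bigr => p _.
      rewrite (partition_big (fun q : Anc * S => (q.1, h q.2)) predT) //=.
      over.
    rewrite exchange_big /=; apply: eq_bigr => -[a' t'] _.
    rewrite /ampliation !entry_mkop /=.
    transitivity (\sum_(y | h y == t) \sum_(y' | (r y == r y') && (h y' == t'))
      (f (a, t))^* * entry A (a, y) (a', y') * f (a', t')).
      rewrite big_distrr big_distrl /= [RHS]big_mkcond /=.
      apply: eq_bigr => y _; case: eqP => [_|_].
        rewrite big_distrr big_distrl /=.
        apply: eq_big => [y'|y' _]; first by rewrite andbC.
        by rewrite entry_mkop.
      by rewrite big_pred0_eq mulr0 mul0r.
    rewrite (reindex_onto (fun y => (a, y)) snd) /=; last first.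
      by move=> [a1 y] /=; rewrite xpair_eqE => /andP[/eqP-> _].
    apply: eq_big => [y|y /eqP hy]; first by rewrite xpair_eqE !eqxx andbT.
    rewrite (reindex_onto (fun y => (a', y)) snd) /=; last first.
      by move=> [a1 y1] /=; rewrite xpair_eqE => /andP[_ /andP[/eqP-> _]].
    apply: eq_big => [y'|y' /andP[_ /eqP hy']]; last by rewrite hy hy'.
    by rewrite xpair_eqE !eqxx andbT.
  rewrite [RHS]exchange_big /=; apply: eq_bigr => p _.
  rewrite [RHS]exchange_big /= big_mkcond; apply: eq_bigr => q _.
  rewrite [RHS](bigD1 (r p.2)) //= big1 => [|e /negPf ne].
    rewrite /g eqxx mul1r addr0 [r q.2 == _]eq_sym.
    by case: (_ == _); rewrite ?mul1r // mul0r mulr0.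
  by rewrite /g eq_sym ne mul0r conjC0 !mul0r.
by apply: sumr_ge0 => e _; apply: Apos.
Qed.

Hypothesis hr_inj : forall y y', h y = h y' -> r y = r y' -> y = y'.

(** Joint injectivity of [h] and [r] makes |y> |-> |h y>|r y> an isometry: on the diagonal only the
    terms with y' = y survive. *)
Lemma coherent_map_tp : trace_preserving coherent_map.
Proof.
move=> A; rewrite !trace_entry.
under eq_bigr do rewrite entry_mkop.
rewrite exchange_big /=; apply: eq_bigr => y _.
rewrite (bigD1 (h y)) //= [X in _ + X]big1 => [|t /negPf ne]; last first.
  by rewrite big1 // => y' /and3P[/eqP hy]; rewrite -hy eqxx in ne.
rewrite addr0 (bigD1 y) ?eqxx //= big1 ?addr0 // => y' /andP[].
by case/andP=> /eqP hy /eqP ry /negP[]; apply/eqP/hr_inj.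
Qed.

Definition coherent_channel : channel C S T :=
  Channel coherent_map_cp coherent_map_tp.

Lemma coherent_channel_ketbra x x' t t' :
  entry (chan_map coherent_channel (ketbra C x x')) t t' =
  [&& h x == t, h x' == t' & r x == r x']%:R.
Proof.
rewrite entry_mkop (bigD1 x) //= [X in _ + X]big1 ?addr0 => [|y /negPf ne];
  last first.
  apply: big1 => y' _; rewrite /entry mxE.
  by rewrite (inj_eq enum_rank_inj) ne.
rewrite big_mkcond (bigD1 x') //= big1 ?addr0 => [|y /negPf ne]; last first.
  by rewrite /entry mxE !(inj_eq enum_rank_inj) ne andbF if_same.
by rewrite /entry mxE !eqxx; case: [&& _, _ & _].
Qed.

End CoherentMap.

Lemma prodr_bool (I : finType) (P : pred I) :
  \prod_i (P i)%:R = [forall i, P i]%:R :> C.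
Proof.
case: forallP => [Pall|nP]; first by rewrite big1 // => i _; rewrite Pall.
have /existsP[i /negPf Pi] : [exists i, ~~ P i].
  by rewrite -negb_forall; apply/negP=> /forallP.
by rewrite (bigD1 i) //= Pi mul0r.
Qed.

Definition dmap (I : finType) (S T : I -> finType) (h : forall i, S i -> T i)
  (x : {dffun forall i, S i}) : {dffun forall i, T i} := [ffun i => h i (x i)].

(** On matrix units every factor has entries 0 or 1, so the product is the indicator of a
    conjunction, and the coherent map of [dmap h] and [dmap r] results. *)
Lemma tensor_coherent (I : finType) (S T E : I -> finType)
    (h : forall i, S i -> T i) (r : forall i, S i -> E i)
    (hr : forall i y y', h i y = h i y' -> r i y = r i y' -> y = y')
    (A : op C (tensor_basis S)) (t t' : tensor_basis T) :
  entry (tensor_channel (fun i => coherent_channel (@hr i)) A) t t' =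
  \sum_(x : tensor_basis S | dmap h x == t)
    \sum_(x' : tensor_basis S | (dmap h x' == t') && (dmap r x == dmap r x'))
      entry A x x'.
Proof.
rewrite entry_mkop [RHS]big_mkcond /=; apply: eq_bigr => x _.
have dE (J : finType) (U : J -> finType) (f g : {dffun forall i, U i}) :
    (f == g) = [forall i, f i == g i].
  by apply/eqP/forallP=> [-> i //|fg]; apply/ffunP=> i; apply/eqP.
have condE (x' : tensor_basis S) : [forall i, [&& h i (x i) == t i,
    h i (x' i) == t' i & r i (x i) == r i (x' i)]] =
  [&& dmap h x == t, dmap h x' == t' & dmap r x == dmap r x'].
  rewrite !dE.
  apply/forallP/and3P => [H|[/forallP H1 /forallP H2 /forallP H3] i].
    by split; apply/forallP=> i; case/and3P: (H i); rewrite !ffunE.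
  by move: (H1 i) (H2 i) (H3 i); rewrite !ffunE => -> -> ->.
have prodE (x' : tensor_basis S) : \prod_(i : I) entry (chan_map
      (coherent_channel (@hr i)) (ketbra C (x i) (x' i))) (t i) (t' i) =
    [&& dmap h x == t, dmap h x' == t' & dmap r x == dmap r x']%:R.
  by rewrite -condE -prodr_bool; apply: eq_bigr => i _;
    rewrite coherent_channel_ketbra.
under eq_bigr => x' _ do rewrite prodE.
case: eqP => _ /=; last by rewrite big1 // => x' _; rewrite mulr0.
rewrite [RHS]big_mkcond; apply: eq_bigr => x' _.
by case: (_ && _); rewrite ?mulr1 ?mulr0.
Qed.

(** For nonempty [A], the pure state |phi><phi| where phi is the normalised sum of the |x> with x in
    [A]. *)
Definition uniform_state (T : finType) (A : {set T}) : op C T :=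
  mkop (fun x y => ((x \in A) && (y \in A))%:R / #|A|%:R).

Lemma uniform_state_is_state (T : finType) (A : {set T}) :
  A != set0 -> is_state (uniform_state A).
Proof.
move=> A0; have cA0 : #|A|%:R != 0 :> C by rewrite pnatr_eq0 cards_eq0.
split; last first.
  rewrite trace_entry; under eq_bigr do rewrite entry_mkop andbb.
  rewrite -mulr_suml -natr_sum -big_mkcond sum1_card.
  by rewrite -[X in X / _]/(#|A|%:R) divff.
apply/psdP => f; pose s := \sum_(x in A) f x.
rewrite (_ : \sum_x _ = s^* * s / #|A|%:R).
  by rewrite divr_ge0 // mulrC mul_conjC_ge0.
rewrite rmorph_sum !mulr_suml [RHS]big_mkcond /=; apply: eq_bigr => x _.
rewrite mulr_sumr mulr_suml.
case: ifP => xA; last first.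
  by apply: big1 => y _; rewrite entry_mkop xA mul0r mulr0 mul0r.
rewrite [RHS]big_mkcond /=; apply: eq_bigr => y _; rewrite entry_mkop xA /=.
case: ifP => _; last by rewrite mul0r mulr0 mul0r.
by rewrite mul1r mulrAC.
Qed.

End Operators.

(** Serves to collapse a coherent map followed by another one, or by a partial trace, into one
    double sum over the inputs. *)
Lemma sum_fibers2 (V : zmodType) (X Z : finType) (f : X -> Z) (P : pred Z)
    (Q : rel Z) (R : rel X) (F : X -> X -> V) :
  \sum_(z | P z) \sum_(z' | Q z z')
    \sum_(x | f x == z) \sum_(x' | (f x' == z') && R x x') F x x' =
  \sum_(x | P (f x)) \sum_(x' | Q (f x) (f x') && R x x') F x x'.
Proof.
rewrite [RHS](partition_big f P) //=; apply: eq_bigr => z Pz.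
rewrite exchange_big /=.
apply: eq_big => [x|x /eqP fx].
  by case: eqP => [->|_]; rewrite ?Pz ?andbF.
rewrite [RHS](partition_big f (Q z)) => [|x' /andP[]]; last by rewrite fx.
apply: eq_bigr => z' Qz; apply: eq_bigl => x'; rewrite fx.
by rewrite andbC; case: eqP => [->|_]; rewrite ?Qz ?andbF ?andbT.
Qed.

(** * Protocols whose channels act by functions on basis labels *)

Section BasisProtocol.
Variables (C : numClosedFieldType) (d : nat) (G : causal_graph).
Variables (X : G -> finType) (Y : G -> G -> finType) (E : G -> finType).
Variable A : {set tensor_basis X}.
Hypothesis A_neq0 : A != set0.
Variable enc : forall u (b : bool), X u -> outgoing Y u.
Hypothesis enc_inj : forall u b, injective (@enc u b).
Variable dec : forall u (b : bool), incoming Y u -> 'I_d.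
Variable env : forall u (b : bool), incoming Y u -> E u.
Hypothesis dec_env_inj : forall u b y y',
  @dec u b y = @dec u b y' -> @env u b y = @env u b y' -> y = y'.

(** An injective encoding is an isometry by itself, so its traced-out register can be trivial. *)
Lemma enc_tt_inj u b x x' :
  @enc u b x = @enc u b x' -> (fun=> tt) x = (fun=> tt) x' -> x = x'.
Proof. by move/enc_inj. Qed.

Definition basis_protocol : protocol C d G :=
  Protocol (uniform_state_is_state C A_neq0)
    (fun u b => coherent_channel C (@enc_tt_inj u b))
    (fun u b => coherent_channel C (@dec_env_inj u b)).

Definition received (b : G -> bool) (x : tensor_basis X) :
    {dffun forall v, incoming Y v} :=
  [ffun v => [ffun u : {u | link u v} =>
    @enc (val u) (b (val u)) (x (val u))
      (exist (fun w => link (val u) w) v (valP u))]].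

Lemma by_sender_received b x :
  by_sender (received b x) = dmap (fun u => @enc u (b u)) x.
Proof.
apply/ffunP=> u; rewrite !ffunE; apply/ffunP=> v; rewrite !ffunE /=.
case: v => v uv; rewrite /=; set pf := valP _.
by rewrite (bool_irrelevance pf uv).
Qed.

Lemma by_sender_inj : injective (@by_sender G Y).
Proof.
move=> y y' yy'; apply/ffunP=> v; apply/ffunP=> u.
have := congr1 (fun f : tensor_basis (outgoing Y) =>
  f (val u) (exist (fun w => link (val u) w) v (valP u))) yy'.
rewrite !ffunE /=.
case: u => u uv; rewrite /=; set pf := valP _.
by rewrite (bool_irrelevance pf uv).
Qed.

Lemma received_inj b : injective (received b).
Proof.
move=> x x' /(congr1 (@by_sender G Y)); rewrite !by_sender_received => xx'.
apply/ffunP=> u; apply: (@enc_inj u (b u)).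
by have /ffunP/(_ u) := xx'; rewrite !ffunE.
Qed.

Definition output b x := dmap (fun u => @dec u (b u)) (received b x).
Definition residue b x := dmap (fun u => @env u (b u)) (received b x).

Lemma output_residue_inj b x x' :
  output b x = output b x' -> residue b x = residue b x' -> x = x'.
Proof.
move=> /ffunP eo /ffunP er; apply: (@received_inj b); apply/ffunP => u.
by apply: (@dec_env_inj u (b u)); [have := eo u|have := er u]; rewrite !ffunE.
Qed.

Lemma final_state_entry b t t' :
  entry (final_state basis_protocol b) t t' =
  \sum_(x | output b x == t)
    \sum_(x' | (output b x' == t') && (residue b x == residue b x'))
      entry (uniform_state C A) x x'.
Proof.
rewrite /final_state tensor_coherent.
pose Q (z z' : {dffun forall v, incoming Y v}) :=
  (dmap (fun u => @dec u (b u)) z' == t') &&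
  (dmap (fun u => @env u (b u)) z == dmap (fun u => @env u (b u)) z').
transitivity (\sum_(x | output b x == t) \sum_(x' | Q (received b x)
  (received b x') && true) entry (uniform_state C A) x x'); last first.
  by apply: eq_bigr => x _; apply: eq_bigl => x'; rewrite andbT.
rewrite -(sum_fibers2 (received b)
  (fun z => dmap (fun u => @dec u (b u)) z == t) Q (fun _ _ => true)).
apply: eq_bigr => z _; apply: eq_bigr => z' _.
rewrite entry_mkop tensor_coherent.
apply: eq_big => [x|x _].
  by rewrite -(inj_eq by_sender_inj) by_sender_received.
apply: eq_bigl => x'; rewrite -(inj_eq by_sender_inj) by_sender_received.
by congr (_ && _); apply/eqP/ffunP => u; rewrite !ffunE.
Qed.

Definition agree_off (j k : G) (x y : {dffun forall i : G, 'I_d}) :=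
  [forall i, (i != j) && (i != k) ==> (x i == y i)].

(** By the second hypothesis a branch with output p has, for every q, a partner with output q that
    neither the residue nor the other outputs distinguish from it. Hence all |pp><qq| get the same
    weight 1/d. *)
Lemma basis_protocol_marginal b j k :
  {in A, forall x, output b x j = output b x k} ->
  (forall x (q : 'I_d), x \in A -> exists2 x', x' \in A &
     [/\ output b x' j = q, residue b x' = residue b x &
         agree_off j k (output b x) (output b x')]) ->
  marginal2 j k (final_state basis_protocol b) = max_entangled C d.
Proof.
move=> out_eq shift.
pose coh x x' := (residue b x == residue b x')
   && agree_off j k (output b x) (output b x').
have coh_sym x x' : coh x x' = coh x' x.
  rewrite /coh eq_sym; congr (_ && _).
  by apply: eq_forallb => i; rewrite [output b x i == _]eq_sym.
pose N p := #|[set x in A | output b x j == p]|.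
(* The partner is unique because output and residue together determine the branch, so the coherent
   pairs are as many as the branches with output p. *)
have count p q : \sum_(x in A | output b x j == p)
    \sum_(x' in A | (output b x' j == q) && coh x x') 1 = (N p)%:R :> C.
  rewrite /N -sum1_card natr_sum.
  apply: eq_big => [x|x /andP[xA /eqP xp]]; first by rewrite inE.
  have [x1 x1A [x1q x1r x1o]] := shift x q xA.
  rewrite (bigD1 x1) /=; last first.
    by rewrite x1A x1q eqxx /coh x1r eqxx x1o.
  rewrite big1 ?addr0 // => x2 /andP[/andP[x2A /andP[/eqP x2q]]].
  case/andP=> /eqP x2r /forallP x2o /negP[]; apply/eqP.
  apply: (@output_residue_inj b); last by rewrite -x2r.
  apply/ffunP => i; have [->|nj] := eqVneq i j; first by rewrite x1q.
  have [->|nk] := eqVneq i k; first by rewrite -!out_eq // x1q.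
  have := x2o i; rewrite nj nk /= => /eqP <-.
  by have /forallP/(_ i) := x1o; rewrite nj nk /= => /eqP <-.
(* Double counting of the coherent pairs, from either end. *)
have N_const p q : (N p)%:R = (N q)%:R :> C.
  rewrite -(count p q) -(count q p).
  rewrite (exchange_big_dep (fun x => (x \in A) && (output b x j == q))) /=.
    by apply: eq_bigr => x /andP[-> ->]; apply: eq_bigl => x' /=;
      rewrite coh_sym andbA.
  by move=> x x' _ /and3P[-> ->].
have N_card p : d%:R * (N p)%:R = #|A|%:R :> C.
  rewrite -[in RHS]sum1_card (partition_big (fun x => output b x j) predT) //=.
  rewrite natr_sum -[d in LHS]card_ord mulr_natl -sumr_const.
  apply: eq_bigr => q _; rewrite (N_const p q) /N -sum1_card.
  by congr (_%:R); apply: eq_bigl => x; rewrite inE.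
have cA0 : #|A|%:R != 0 :> C by rewrite pnatr_eq0 cards_eq0.
apply: op_eqP => -[p1 p2] [q1 q2]; rewrite entry_mkop /=.
under eq_bigr do under eq_bigr do rewrite final_state_entry.
pose P (t : {dffun forall i : G, 'I_d}) := (t j == p1) && (t k == p2).
pose Q (t t' : {dffun forall i : G, 'I_d}) :=
  [&& t' j == q1, t' k == q2 & agree_off j k t t'].
rewrite (sum_fibers2 (output b) P Q (fun x x' => residue b x == residue b x')).
transitivity ((p1 == p2)%:R * (q1 == q2)%:R * (N p1)%:R / #|A|%:R : C).
  rewrite -(count p1 q1) mulr_sumr mulr_suml big_mkcond [RHS]big_mkcond /=.
  apply: eq_bigr => x _; rewrite /P.
  have [xA|xA] := boolP (x \in A); last first.
    case: ifP => // _; apply: big1 => x' _.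
    by rewrite entry_mkop (negPf xA) mul0r.
  rewrite -(out_eq x xA) /=.
  have [xp|_] //= := eqVneq (output b x j) p1; rewrite xp.
  have [_|_] //= := eqVneq p1 p2; last by rewrite !mul0r.
  rewrite mul1r mulr_sumr mulr_suml big_mkcond [RHS]big_mkcond /=.
  apply: eq_bigr => x' _; rewrite /Q entry_mkop xA /=.
  have [x'A|x'A] := boolP (x' \in A); last by rewrite mul0r if_same.
  rewrite -(out_eq x' x'A) /coh /= mulr1.
  have [->|_] //= := eqVneq (output b x' j) q1.
  by case: (q1 == q2); case: (residue b x == _); case: agree_off;
    rewrite ?mul0r ?if_same ?andbF.
rewrite /max_entangled /entry !mxE big_ord1 !mxE !enum_rankK /=.
have [_|_] := eqVneq p1 p2; last by rewrite !mul0r.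
have [_|_] := eqVneq q1 q2; last by rewrite conjC0 mulr0 mul0r !mulr0 ?mul0r.
rewrite !mul1r -(N_card p1).
have /andP[d0 N0] : (d%:R != 0 :> C) && ((N p1)%:R != 0 :> C).
  by rewrite -negb_or -mulf_eq0 N_card.
rewrite invfM mulrCA divff // mulr1.
rewrite (CrealP _); last by rewrite rpredV ger0_real // sqrtC_ge0 ler0n.
by rewrite -invfM -expr2 sqrtCK.
Qed.

End BasisProtocol.

(** * The summoning code, its routing and its decoding *)

Section Summoning.
Variables (C : numClosedFieldType) (n : nat) (G : causal_graph).
Let Z := 'I_n.+1.

(* A resource is indexed by a pair of vertex sets, in each of which one half of
   an entangled pair can be summoned; the boolean selects the set. *)
Definition endpoint := ({set G} * {set G} * bool)%type.
Definition part (h : endpoint) : {set G} := if h.2 then h.1.2 else h.1.1.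
Definition opposite (h : endpoint) : endpoint := (h.1, ~~ h.2).

Definition orient (u w : G) : bool :=
  arrow u w && (arrow w u ==> (enum_rank u < enum_rank w)%N).

Lemma orient_arrow u w : orient u w -> arrow u w.
Proof. by case/andP. Qed.

Lemma orient_asym u w : orient u w -> ~~ orient w u.
Proof.
move=> /andP[uw lt]; apply/negP=> /andP[wu]; rewrite uw wu in lt *.
by rewrite /= ltnNge ltnW.
Qed.

Lemma orient_irr u : orient u u = false.
Proof. by rewrite /orient arrow_irrefl. Qed.

Lemma orient_total u w : related u w -> u != w -> orient u w || orient w u.
Proof.
rewrite /related /orient => r ne; move: r; rewrite (negPf ne) /=.
case: (arrow u w); case: (arrow w u) => //= _.
by rewrite -neq_ltn; apply: contra ne => /eqP/ord_inj/enum_rank_inj/eqP.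
Qed.

Definition config := {ffun endpoint * G -> Z}.
Definition total (c : config) (h : endpoint) : Z := \sum_(u in part h) c (h, u).

(** Register (h, w) at u holds the vertex value if w = u and the value of the edge u -> w otherwise;
    pairs that carry no edge of the code are padded with 0. *)
Definition share (c : config) (u : G) (hw : endpoint * G) : Z :=
  if u == hw.2 then c (hw.1, u) else
  if [&& orient u hw.2, u \in part hw.1 & hw.2 \in part hw.1]
  then c (hw.1, u) + c hw else 0.

(** For a pair of nonempty sets, equal totals put the two encoded halves in the superposition of the
    |m>|m>. *)
Definition balanced : {set config} :=
  [set c | [forall a, total c (a, false) == total c (a, true)]].

Definition share_space (u : G) : finType := {ffun endpoint * G -> Z}.
Definition message_space (u v : G) : finType :=
  ({ffun endpoint * G -> Z} * bool)%type.

Definition shares (c : config) : tensor_basis share_space :=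
  [ffun u => [ffun hw => share c u hw]].

Definition codeword : {set tensor_basis share_space} := shares @: balanced.

Lemma codeword_neq0 : codeword != set0.
Proof.
apply/set0Pn; exists (shares [ffun=> 0]); apply: imset_f.
rewrite inE; apply/forallP => a; rewrite /total.
by rewrite !big1 // => u _; rewrite ffunE.
Qed.

Definition destination (u : G) (b : bool) (w : G) : G :=
  if ~~ b && orient u w then w else u.

(** All links have the same message space, so a register routed elsewhere shows up as 0. The bit
    lets the receiver hear of the request. *)
Definition send (u : G) (b : bool) (x : share_space u) :
    outgoing message_space u :=
  [ffun v : {v | link u v} =>
    ([ffun hw => if destination u b hw.2 == val v then x hw else 0], b)].

Lemma destination_link u b w : link u (destination u b w).
Proof.
rewrite /destination /link; case: ifP => [/andP[_ /orient_arrow ->]|_].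
  by rewrite orbT.
by rewrite eqxx.
Qed.

Lemma send_inj u b : injective (@send u b).
Proof.
move=> x x' /ffunP xx'; apply/ffunP => hw.
have := xx' (exist (link u) _ (destination_link u b hw.2)).
by rewrite !ffunE => -[/ffunP/(_ hw)]; rewrite !ffunE /= eqxx.
Qed.

(** Where no link exists, the defaults are zero registers and no request. *)
Definition get (v : G) (y : incoming message_space v) (u : G) :
    {ffun endpoint * G -> Z} * bool :=
  if insub u is Some u' then y u' else ([ffun=> 0], false).

Lemma get_inj v y y' : (forall u, @get v y u = @get v y' u) -> y = y'.
Proof.
by move=> eqy; apply/ffunP=> u; have := eqy (val u); rewrite /get valK.
Qed.

Definition seen (v : G) (y : incoming message_space v) : {set G} :=
  [set u | (get y u).2].

(** Each edge value minus c_v gives c_w, and all these add up with c_v to m. A requested v finds the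
    values of its outgoing edges in its own memory and the others in the messages from their
    tails. *)
Definition read_off (v : G) (h : endpoint) (y : incoming message_space v) : Z :=
  (get y v).1 (h, v) + \sum_(w in part h | w != v)
    ((if orient v w then (get y v).1 (h, w) else (get y w).1 (h, v))
     - (get y v).1 (h, v)).

(* The shares whose value depends on the coordinate (h, v) of the
   configuration. *)
Definition touches (v : G) (h : endpoint) (u : G) (hw : endpoint * G) : bool :=
  (hw.1 == h) && (if u == hw.2 then u == v else
    [&& orient u hw.2, u \in part h, hw.2 \in part h &
        (u == v) || (hw.2 == v)]).

Variable select : G -> {set G} -> endpoint.

Definition decoded (v : G) (b : bool) (y : incoming message_space v) : Z :=
  if b then read_off (select v (seen y)) y else 0.

(** When the whole star has arrived, subtracting m = sum_u c_u from c_v or c_v + c_w cancels c_v, so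
    what remains depends on the other coordinates only. *)
Definition leftover (v : G) (b : bool) (y : incoming message_space v) :
    {ffun G -> {ffun endpoint * G -> Z} * bool} :=
  [ffun u => ([ffun hw => (get y u).1 hw -
     decoded b y *+ (b && touches v (select v (seen y)) u hw)], (get y u).2)].

(** The request bits survive in the leftover, so [seen] and the selected endpoint are recovered
    first; adding the decoded value back then restores the registers. *)
Lemma decoded_leftover_inj v b y y' :
  @decoded v b y = decoded b y' -> leftover b y = leftover b y' -> y = y'.
Proof.
move=> eqd /ffunP eql; apply: get_inj => u.
have eqs : seen y = seen y'.
  by apply/setP=> w; have := eql w; rewrite !ffunE !inE => -[].
have := eql u; rewrite !ffunE => -[/ffunP eqv eqb].
rewrite [LHS]surjective_pairing [RHS]surjective_pairing eqb.
congr (_, _); apply/ffunP=> hw.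
by have := eqv hw; rewrite !ffunE eqd eqs => /addIr.
Qed.

Definition summoning_protocol : protocol C n.+1 G :=
  basis_protocol C codeword_neq0 send_inj decoded_leftover_inj.

Section Run.
Variable b : G -> bool.

Definition arrived (c : config) (v : G) : incoming message_space v :=
  received send b (shares c) v.

Lemma get_arrived c v u : get (arrived c v) u =
  if link u v then
    ([ffun hw => if destination u (b u) hw.2 == v then share c u hw else 0],
     b u)
  else ([ffun=> 0], false).
Proof.
rewrite /get; case: insubP => [u' uv vu|/negPf -> //]; rewrite uv -vu.
rewrite /arrived /received !ffunE /=.
by congr (_, _); apply/ffunP => hw; rewrite !ffunE.
Qed.

Lemma seen_arrived c v : seen (arrived c v) = [set u | link u v && b u].
Proof. by apply/setP=> u; rewrite !inE get_arrived; case: link. Qed.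

(* Under these conditions all the shares that depend on the coordinate (h, v)
   reach v. *)
Definition wins (v : G) (h : endpoint) : Prop :=
  [/\ b v, v \in part h & forall w, w \in part h -> w != v ->
    orient v w \/ orient w v /\ ~~ b w].

Lemma read_off_arrived c v h : wins v h -> read_off h (arrived c v) = total c h.
Proof.
case=> bv vh winv; rewrite /read_off /total (bigD1 v vh) /=.
have vv : link v v by rewrite /link eqxx.
have -> : (get (arrived c v) v).1 (h, v) = c (h, v).
  by rewrite get_arrived vv ffunE /= /destination orient_irr andbF eqxx
    /share /= eqxx.
congr (_ + _); apply: eq_bigr => w /andP[wh nwv].
have [vw|[wv nbw]] := winv w wh nwv.
  rewrite vw get_arrived vv ffunE /= /destination bv eqxx /share /=.
  by rewrite eq_sym (negPf nwv) vw vh wh /= addrC addKr.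
rewrite (negPf (orient_asym wv)) get_arrived /link (orient_arrow wv) orbT /=.
rewrite ffunE /= /destination nbw wv eqxx /share /=.
by rewrite (negPf nwv) wv vh wh /= addrK.
Qed.

Definition bump (c : config) (v : G) (h : endpoint) (t : Z) : config :=
  [ffun x => c x + t *+ (x == (h, v))].

Lemma total_bump c v h t h' : v \in part h ->
  total (bump c v h t) h' = total c h' + t *+ (h' == h).
Proof.
move=> vh; rewrite /total.
under eq_bigr do rewrite ffunE xpair_eqE.
rewrite big_split /=; congr (_ + _); have [->|_] := eqVneq h' h; last first.
  by rewrite big1.
by rewrite (bigD1 v vh) /= eqxx big1 ?addr0 // => w /andP[_ /negPf ->].
Qed.

Lemma share_bump c v h t u hw :
  share (bump c v h t) u hw = share c u hw + t *+ touches v h u hw.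
Proof.
case: hw => h' w; rewrite /share /touches /= !ffunE !xpair_eqE.
have [->|_] /= := eqVneq h' h; last by rewrite !mulr0n !addr0; do !case: ifP.
have [//|uw] := eqVneq u w.
case: (orient u w) => /=; last by rewrite addr0.
case: (u \in part h) => /=; last by rewrite addr0.
case: (w \in part h) => /=; last by rewrite addr0.
rewrite addrACA -mulrnDr; congr (_ + _ *+ _).
(* Since u <> w, at most one of them is v, so the two indicators add up to their disjunction. *)
by case: eqVneq => [uv|]; case: eqVneq => [wv|] //; rewrite uv wv eqxx in uw.
Qed.

(** Such a share either sits at v, which keeps it because v is requested, or on an edge into v whose
    tail is unrequested by [wins] and therefore forwards it. *)
Lemma touches_destination v h u hw :
  wins v h -> touches v h u hw -> destination u (b u) hw.2 = v.
Proof.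
case: hw => h' w [bv vh winv] /andP[_] /=; rewrite /destination.
have [->|uw] := eqVneq u w; first by rewrite orient_irr andbF => /eqP.
case/and4P=> ouw uh wh /orP[/eqP uv|/eqP wv]; first by rewrite uv bv.
rewrite wv in ouw uw *; have [vu|[_ ->]] := winv u uh uw.
  by rewrite (negPf (orient_asym vu)) in ouw.
by rewrite ouw.
Qed.

Lemma get_bump c v h t v' u hw : wins v h ->
  (get (arrived (bump c v h t) v') u).1 hw =
  (get (arrived c v') u).1 hw + t *+ [&& v' == v, link u v' & touches v h u hw].
Proof.
move=> winv; rewrite !get_arrived; case: (link u v') => /=; last first.
  by rewrite andbF addr0.
rewrite !ffunE share_bump; have [tch|_] := boolP (touches v h u hw).
  rewrite (touches_destination winv tch) eq_sym andbT.
  by case: eqP => _; rewrite ?addr0.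
by rewrite andbF !addr0.
Qed.

End Run.

Lemma touches_link b v h u hw : wins b v h -> touches v h u hw -> link u v.
Proof.
by move=> winv tch; rewrite -(touches_destination winv tch) destination_link.
Qed.

Theorem summoning_protocol_correct (j k : G) :
  let b u := (u == j) || (u == k) in
  let h v := select v [set u | link u v && b u] in
  wins b j (h j) -> wins b k (h k) -> j != k -> h k = opposite (h j) ->
  marginal2 j k (final_state summoning_protocol b) = max_entangled C n.+1.
Proof.
move=> b h winj wink njk hk.
have decE c v : wins b v (h v) -> decoded (b v) (arrived b c v) = total c (h v).
  by move=> winv; rewrite /decoded seen_arrived (read_off_arrived _ winv);
    case: winv => ->.
have outE c v : output send decoded b (shares c) v =
    decoded (b v) (arrived b c v) by rewrite ffunE.
have resE c v : residue send leftover b (shares c) v =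
    leftover (b v) (arrived b c v) by rewrite ffunE.
have opp_total c : c \in balanced -> total c (h j) = total c (h k).
  rewrite inE hk => /forallP/(_ (h j).1)/eqP.
  by rewrite /opposite; case: (h j) => a [].
apply: basis_protocol_marginal => [x /imsetP[c cbal ->]|x q /imsetP[c cbal ->]].
  by rewrite !outE !decE // opp_total.
pose t := q - total c (h j).
have [[_ jh _] [_ kh _]] := (winj, wink).
(* Equal shifts at the two opposite endpoints keep the configuration balanced and turn the common
   total into q. *)
pose c' := bump (bump c j (h j) t) k (h k) t.
have nh : (h k == h j) = false.
  by rewrite hk /opposite; case: (h j) => a [] /=; rewrite xpair_eqE andbF.
have totE v : v = j \/ v = k -> total c' (h v) = total c (h v) + t.
  rewrite /c' !total_bump //.
  by case=> ->; rewrite eqxx ?nh 1?eq_sym ?nh ?mulr1n !addr0.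
have c'bal : c' \in balanced.
  rewrite inE; apply/forallP=> a; rewrite !total_bump // hk.
  move: cbal; rewrite inE => /forallP/(_ a)/eqP ->; apply/eqP.
  rewrite -!addrA; congr (_ + _); rewrite /opposite.
  case: (h j) => a0 s /=; rewrite !xpair_eqE.
  by case: (a == a0); case: s; rewrite /= ?addr0 ?add0r.
exists (shares c'); first exact: imset_f.
split.
- by rewrite outE decE // totE; [rewrite /t addrC subrK|left].
(* At j and k the touched registers and the decoded total both grow by t, so their difference is
   unchanged; no other vertex receives a touched register. *)
- apply/ffunP=> v; rewrite !resE; apply/ffunP=> u; rewrite !ffunE !seen_arrived.
  congr (_, _); last by rewrite !get_arrived; case: link.
  apply/ffunP=> hw; rewrite !ffunE !get_bump // -/(h v).
  have [vj|nvj] := eqVneq v j.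
    rewrite vj (negPf njk) addr0 !decE // totE; last by left.
    have -> : b j by rewrite /b eqxx.
    have [tch|_] := boolP (touches j (h j) u hw); last by rewrite !andbF !addr0.
    by rewrite (touches_link winj tch) /= !mulr1n [total _ _ + _]addrC addrKA.
  have [vk|nvk] := eqVneq v k.
    rewrite vk addr0 !decE // totE; last by right.
    have -> : b k by rewrite /b eqxx orbT.
    have [tch|_] := boolP (touches k (h k) u hw); last by rewrite !andbF !addr0.
    by rewrite (touches_link wink tch) /= !mulr1n [total _ _ + _]addrC addrKA.
  by rewrite /b (negPf nvj) (negPf nvk) /= !mulr0n !addr0.
- apply/forallP=> v; apply/implyP=> /andP[/negPf nj /negPf nk].
  by rewrite !outE /decoded /b nj nk.
Qed.

End Summoning.

(** * Shores of the unrelatedness components and the choice of the resource *)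

Section Strategy.
Variable G : causal_graph.
Variables K1 K2 : {set G}.
Hypothesis K12 : two_quasi_clique_partition K1 K2.
Hypothesis M1 : M1star G.
Hypothesis M3 : M3star G.

Definition unrelated : rel G := fun u v => ~~ related u v.

Lemma related_sym (u v : G) : related u v = related v u.
Proof. by rewrite /related eq_sym [arrow v u || _]orbC. Qed.

Lemma unrelated_sym : symmetric unrelated.
Proof. by move=> u v; rewrite /unrelated related_sym. Qed.

Lemma partition_notin (L1 L2 : {set G}) u :
  two_quasi_clique_partition L1 L2 -> (u \in L2) = (u \notin L1).
Proof.
move=> [/setP/(_ u) e0 /setP/(_ u) eT _ _]; move: e0 eT; rewrite !inE.
by case: (u \in L1); case: (u \in L2).
Qed.

Lemma unrelated_sides (L1 L2 : {set G}) u v :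
  two_quasi_clique_partition L1 L2 -> unrelated u v ->
  (u \in L1) = (v \notin L1).
Proof.
move=> L12; have [_ _ q1 q2] := L12; rewrite /unrelated /related !negb_or.
case/and3P=> nuv /negPf auv /negPf avu.
have := q1 u v; have := q2 u v; rewrite !(partition_notin _ L12) auv avu nuv.
by case: (u \in L1); case: (v \in L1) => in2 in1 //;
  [have := in1 isT isT isT | have := in2 isT isT isT].
Qed.

(** Every unrelated step flips the side in both partitions, so the parity along a path is the same
    for both. *)
Lemma connected_sides (L1 L2 : {set G}) u v :
  two_quasi_clique_partition L1 L2 -> connect unrelated u v ->
  (u \in L1) (+) (v \in L1) = (u \in K1) (+) (v \in K1).
Proof.
move=> L12 /connectP[p]; elim: p u => [|w p IH] u /=.
  by move=> _ ->; rewrite !addbb.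
case/andP=> uw wp vE; have := IH w wp vE.
rewrite (unrelated_sides L12 uw) (unrelated_sides K12 uw).
by case: (w \in L1); case: (w \in K1); case: (v \in L1); case: (v \in K1).
Qed.

Definition component (u : G) : {set G} := [set v | connect unrelated u v].
Definition side (u : G) : bool := u \notin K1.
Definition shore (D : {set G}) (s : bool) : {set G} :=
  [set u in D | side u == s].
Definition targets (Q : {set G}) : {set G} :=
  [set w | [exists v in Q, one_way v w]].
Definition reach (D : {set G}) (s : bool) : {set G} :=
  shore D s :|: targets (shore D (~~ s)).
Definition own_endpoint (u : G) : endpoint G :=
  (reach (component u) false, reach (component u) true, side u).

Lemma part_own_endpoint u :
  part (own_endpoint u) = reach (component u) (side u).
Proof. by rewrite /part /=; case: side. Qed.

Lemma part_opposite_own_endpoint u :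
  part (opposite (own_endpoint u)) = reach (component u) (~~ side u).
Proof. by rewrite /part /=; case: side. Qed.

Lemma shore_same_part u s v w (L1 L2 : {set G}) :
  v \in shore (component u) s -> w \in shore (component u) s ->
  two_quasi_clique_partition L1 L2 -> same_part L1 L2 v w.
Proof.
rewrite !inE => /andP[uv /eqP sv] /andP[uw /eqP sw] L12.
have vw : connect unrelated v w.
  by apply: connect_trans uw; rewrite (sym_connect_sym unrelated_sym).
have := connected_sides L12 vw; rewrite /same_part !(partition_notin _ L12).
have : side v = side w by rewrite sv.
rewrite /side.
by case: (v \in K1); case: (w \in K1); case: (v \in L1); case: (w \in L1).
Qed.

(** M1 would give a partition separating v from w, but no partition splits a shore. *)
Lemma shore_not_one_way u s v w :
  v \in shore (component u) s -> w \in shore (component u) s -> ~~ one_way v w.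
Proof.
move=> vs ws; apply/negP=> /M1[L1 [L2 [L12]]].
have := shore_same_part vs ws L12; rewrite /same_part /different_parts.
rewrite !(partition_notin _ L12).
by case: (v \in L1); case: (w \in L1).
Qed.

Lemma mem_shore u : u \in shore (component u) (side u).
Proof. by rewrite !inE connect0 eqxx. Qed.

Lemma reach_related u s v w :
  v \in reach (component u) s -> w \in reach (component u) s -> related v w.
Proof.
have shore_shore v1 w1 : v1 \in shore (component u) s ->
    w1 \in shore (component u) s -> related v1 w1.
  move=> v1s w1s; apply/negPn/negP => /(unrelated_sides K12).
  move: v1s w1s; rewrite !inE /side => /andP[_ /eqP <-] /andP[_ /eqP].
  by case: (v1 \in K1); case: (w1 \in K1).
have shore_targets v1 w1 : v1 \in shore (component u) s ->
    w1 \in targets (shore (component u) (~~ s)) -> related v1 w1.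
  move=> v1s; rewrite inE => /existsP[x /andP[xs xw]].
  (* If v were unrelated to w, then w would lie on the shore opposite to v, which is that of x, and
     x -> w would be one-way inside a shore. *)
  apply/negPn/negP => vw; apply: (negP (shore_not_one_way xs _) xw).
  move: v1s (unrelated_sides K12 vw).
  rewrite !inE /side => /andP[uv /eqP <-] ->.
  by rewrite (connect_trans uv (connect1 vw)) !negbK eqxx.
rewrite !in_setU => /orP[vs|vt] /orP[ws|wt].
- exact: shore_shore.
- exact: shore_targets.
- by rewrite related_sym; apply: shore_targets.
- move: vt wt; rewrite !inE => /existsP[v1 /andP[v1s vv]].
  move=> /existsP[w1 /andP[w1s ww]].
  by apply: (M3 _ vv ww) => L1 L2; apply: (shore_same_part v1s w1s).
Qed.

(** [orient] fixes the order of the singletons, so that the two ends of a bidirected edge name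
    opposite halves of one resource; the selected part is the singleton of v. *)
Definition pair_endpoint (v u : G) : endpoint G :=
  if orient v u then ([set v], [set u], false) else ([set u], [set v], true).

(* Of two requested vertices, the one that sees less dictates the resource. *)
Definition strategy (v : G) (S : {set G}) : endpoint G :=
  if [pick u in S | u != v] is Some u then
    if arrow v u then pair_endpoint v u else opposite (own_endpoint u)
  else own_endpoint v.

Section Request.
Variables (j k : G) (b : G -> bool).
Hypothesis njk : j != k.
Hypothesis bE : forall u, b u = (u == j) || (u == k).
Let selected v := strategy v [set u | link u v && b u].

Lemma strategyE : selected j =
  if arrow k j then
    if arrow j k then pair_endpoint j k else opposite (own_endpoint k)
  else own_endpoint j.
Proof.
rewrite /selected /strategy.
case: pickP => [u|none].
  rewrite !inE bE => /andP[/andP[uj /orP[/eqP->|/eqP uk]]].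
    by rewrite eqxx.
  by move: uj; rewrite uk /link [k == j]eq_sym (negPf njk) /= => ->.
case: ifP => // kj; have := none k.
by rewrite !inE bE /link kj eqxx !orbT [k == j]eq_sym njk.
Qed.

(** Every w other than j and k is unrequested and forwards its edge to j, so the orientation matters
    only on the edge between j and k. *)
Lemma wins_related h : j \in part h ->
  {in part h, forall w, related j w} -> (k \in part h -> orient j k) ->
  wins b j h.
Proof.
move=> jh rel_h kh; split=> [||w wh nwj] //; first by rewrite bE eqxx.
have [wk|nwk] := eqVneq w k; first by left; rewrite wk kh // -wk.
rewrite eq_sym in nwj; have /orP[jw|wj] := orient_total (rel_h w wh) nwj.
  by left.
by right; rewrite bE [w == j]eq_sym (negPf nwj).
Qed.

Lemma strategy_wins : wins b j (selected j).
Proof.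
rewrite strategyE; case: ifP => [kj|nkj]; last first.
  have jr : j \in reach (component j) (side j) by rewrite inE mem_shore.
  apply: wins_related => [|w|]; rewrite part_own_endpoint //.
    exact: reach_related.
  (* If k lies in the set, it is related to j; as k -> j is absent, the edge j -> k is one-way and
     oriented from j. *)
  move=> kr; have := reach_related jr kr.
  by rewrite /related (negPf njk) nkj orbF /orient nkj /= andbT.
case: ifP => [jk|njk'].
  have singl : part (pair_endpoint j k) = [set j].
    by rewrite /pair_endpoint; case: (orient j k).
  apply: wins_related => [|w|]; rewrite singl !inE //.
    by move/eqP->; rewrite /related eqxx.
  by rewrite eq_sym (negPf njk).
have kj1 : one_way k j by rewrite /one_way kj njk'.
have jr : j \in reach (component k) (~~ side k).
  rewrite inE; apply/orP; right; rewrite inE negbK.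
  by apply/existsP; exists k; rewrite mem_shore.
apply: wins_related => [|w|]; rewrite part_opposite_own_endpoint //.
  exact: reach_related.
(* Here k is outside the set: it is not on the opposite shore, and a one-way edge into k from its
   own shore is excluded. *)
rewrite inE => /orP[|].
  by rewrite !inE; case: side; rewrite andbF.
rewrite inE negbK => /existsP[x /andP[xs xk]].
by have := shore_not_one_way xs (mem_shore k); rewrite xk.
Qed.

End Request.

Lemma strategy_opposite (j k : G) (b : G -> bool) : j != k ->
  (forall u, b u = (u == j) || (u == k)) ->
  strategy k [set u | link u k && b u] =
  opposite (strategy j [set u | link u j && b u]).
Proof.
move=> njk bE; rewrite (strategyE njk bE) (@strategyE k j b) 1?eq_sym //;
  last by move=> u; rewrite bE orbC.
have oppK (x : endpoint G) : opposite (opposite x) = x.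
  by case: x => a s; rewrite /opposite /= negbK.
case: ifP => [jk|njk']; case: ifP => [kj|nkj] //.
- have := orient_total _ njk; rewrite /related jk orbT => /(_ isT).
  rewrite /pair_endpoint /opposite.
  by case jk1: (orient j k); case kj1: (orient k j) => //;
    have := orient_asym jk1; rewrite kj1.
(* Neither vertex hears of the other: they are unrelated, hence in one component and on opposite
   shores, so their own endpoints are opposite. *)
- have un : unrelated j k by rewrite /unrelated /related (negPf njk) njk' nkj.
  rewrite /own_endpoint /opposite /=.
  have -> : component k = component j.
    apply/setP=> w; rewrite !inE; apply: same_connect.
      exact: sym_connect_sym unrelated_sym.
    by rewrite connect1 // unrelated_sym.
  by rewrite /side (unrelated_sides K12 un) negbK; case: (k \in K1).
Qed.

End Strategy.

Theorem theorem43 (R : realType) (d : nat) (hd : (2 <= d)%N) (G : causal_graph)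
    (hNOC : NOCstar G) (hM1 : M1star G) (hM3 : M3star G) :
  achievable (complex R) d G.
Proof.
(* Writing the dimension as a successor makes the output labels the additive group of integers
   modulo d. *)
have [K1 [K2 K12]] := hNOC; case: d hd => [//|n] _.
exists (summoning_protocol R[i] n (strategy K1)) => j k njk.
apply: summoning_protocol_correct => //.
- exact: (strategy_wins K12 hM1 hM3 njk).
- apply: (@strategy_wins _ _ _ K12 hM1 hM3 k j); first by rewrite eq_sym.
  by move=> u; rewrite orbC.
- exact: (strategy_opposite K12 njk).
Qed.
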